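(* Let $p>3$ be a prime number. Then $$\sum_{k=1}^{p-1}\frac{1}{k\,2^k}\equiv H'_{p-1}\pmod p .$$
   Context: For an odd prime $p$, $H'_{p-1}:=1+\frac13+\frac15+\dots+\frac1{p-2}$ is the sum of the reciprocals of the odd integers between $1$ and $p-2$. Congruences modulo $p$ are between rational numbers whose denominators are prime to $p$ (i.e. congruences in the localization $\mathbb{Z}_{(p)}$). *)

(* Defs.v *)
From HB Require Import structures.
From mathcomp Require Import all_boot all_order all_algebra.

Set Implicit Arguments.
Unset Strict Implicit.
Unset Printing Implicit Defensive.

Import Order.TTheory GRing.Theory Num.Theory.
Local Open Scope ring_scope.

(* The rationals whose denominator is prime to p; for p prime this is the
   localization Z_(p).  [denq x] is the positive denominator of x in lowest
   terms. *)
Definition Zloc (p : nat) : pred rat := [pred x : rat | coprime p `|denq x|%N].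

(* Congruence modulo the ideal p Z_(p); both sides are required to lie in
   Z_(p). *)
Definition eqmod_loc (p : nat) (x y : rat) : Prop :=
  [/\ x \in Zloc p, y \in Zloc p &
      exists2 z : rat, z \in Zloc p & x - y = p%:R * z].

(* H'_{p-1} = 1 + 1/3 + ... + 1/(p-2) for odd p; the index p - 1 is kept as
   the argument n, and k ranges over the odd integers 1 <= k <= n - 1. *)
Definition odd_harmonic (n : nat) : rat :=
  \sum_(1 <= k < n | odd k) (k%:R)^-1.

(* Main.v *)
(** For [0 < k < p] the identity [C(p,k) / p = C(p-1,k-1) / k] and
    [C(p-1,k-1) = (-1)^(k-1)] mod [p] give
    [1 / k = (-1)^(k-1) C(p,k) / p] mod [p].  By the binomial theorem the two
    sums are then congruent to [(1 - 2^(1-p)) / p] and [q = (2^(p-1) - 1) / p]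
    respectively; these differ by [- p q^2 / 2^(p-1)]. *)
From HB Require Import structures.
Require Import Defs.
From mathcomp Require Import all_boot all_order all_algebra.
From mathcomp Require Import ring.

Set Implicit Arguments.
Unset Strict Implicit.
Unset Printing Implicit Defensive.

Import Order.TTheory GRing.Theory Num.Theory.
Local Open Scope ring_scope.

(** Any denominator prime to [p] will do, reduced or not, which makes the closure properties
    immediate: the reduced denominator divides [numq x * d] and is coprime to [numq x], hence
    divides [d]. *)
Lemma ZlocP (p : nat) (x : rat) :
  reflect (exists2 d : nat, coprime p d & x * d%:R \is a Num.int)
          (x \in Zloc p).
Proof.
apply: (iffP idP) => [px | [d pd /intrP[m xd]]].
  exists `|denq x|%N => //.
  by rewrite natr_absz (gtr0_norm (denq_gt0 x)) -numqE intr_int.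
have : numq x * d%:Z = m * denq x.
  apply/eqP; rewrite -(eqr_int rat) !rmorphM /= numqE -xd.
  by apply/eqP; rewrite -pmulrn; ring.
move/(congr1 absz); rewrite !abszM /= => nd.
apply: coprime_dvdr pd.
rewrite -(@Gauss_dvdr _ `|numq x|%N) ?nd ?dvdn_mull //.
by rewrite coprime_sym coprime_num_den.
Qed.

Lemma Zloc_subring_closed (p : nat) : subring_closed (Zloc p).
Proof.
split=> [|x y /ZlocP[d pd xd] /ZlocP[e pe ye]|x y /ZlocP[d pd xd] /ZlocP[e pe ye]].
- by apply/ZlocP; exists 1%N; rewrite ?coprimen1 ?mulr1 ?rpred1.
- apply/ZlocP; exists (d * e)%N; first by rewrite coprimeMr pd.
  have -> : (x - y) * (d * e)%:R = x * d%:R * e%:R - y * e%:R * d%:R.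
    by rewrite natrM; ring.
  by rewrite rpredB // rpredM // natr_int.
- apply/ZlocP; exists (d * e)%N; first by rewrite coprimeMr pd.
  have -> : x * y * (d * e)%:R = (x * d%:R) * (y * e%:R).
    by rewrite natrM; ring.
  by rewrite rpredM.
Qed.

HB.instance Definition _ (p : nat) :=
  GRing.isSubringClosed.Build rat (Zloc p) (Zloc_subring_closed p).

Lemma Zloc_invn (p d : nat) : (0 < d)%N -> coprime p d -> d%:R^-1 \in Zloc p.
Proof.
move=> d_gt0 pd; apply/ZlocP; exists d => //.
by rewrite mulVf ?rpred1 // pnatr_eq0 -lt0n.
Qed.

Lemma prime_coprime_lt (p k : nat) : prime p -> (0 < k < p)%N -> coprime p k.
Proof.
by move=> p_pr /andP[k_gt0 k_lt]; rewrite prime_coprime // gtnNdvd.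
Qed.

Lemma prime_bin_div_Zloc (p k : nat) :
  prime p -> (0 < k < p)%N -> 'C(p, k)%:R / p%:R \in Zloc p.
Proof.
move=> p_pr kp; have /dvdnP[m ->] := prime_dvd_bin p_pr kp.
by rewrite natrM mulfK ?rpred_nat // pnatr_eq0 -lt0n prime_gt0.
Qed.

(** By Pascal's rule consecutive entries of row [p.-1] add up to an entry of row [p] divisible by
    [p], so they are opposite modulo [p]; induction starts from ['C(p.-1, 0) = 1]. *)
Lemma bin_pred_prime_Zloc (p k : nat) :
  prime p -> (k < p)%N -> ((-1) ^+ k * 'C(p.-1, k)%:R - 1) / p%:R \in Zloc p.
Proof.
move=> p_pr; elim: k => [_|k IHk kp].
  by rewrite bin0 mulr1 subrr mul0r rpred0.
have -> : ((-1) ^+ k.+1 * 'C(p.-1, k.+1)%:R - 1) / p%:R =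
    (-1) ^+ k.+1 * ('C(p, k.+1)%:R / p%:R) +
    ((-1) ^+ k * 'C(p.-1, k)%:R - 1) / p%:R :> rat.
  have -> : 'C(p, k.+1) = ('C(p.-1, k.+1) + 'C(p.-1, k))%N.
    by rewrite -binS prednK ?prime_gt0.
  by rewrite natrD exprS; ring.
rewrite rpredD ?IHk 1?ltnW // rpredM ?rpredX ?rpredN ?rpred1 //.
exact: prime_bin_div_Zloc.
Qed.

Lemma invn_bin_Zloc (p k : nat) : prime p -> (0 < k < p)%N ->
  (k%:R^-1 + (-1) ^+ k * 'C(p, k)%:R / p%:R) / p%:R \in Zloc p.
Proof.
move=> p_pr; case: k => // k kp.
have p0 : p%:R != 0 :> rat by rewrite pnatr_eq0 -lt0n prime_gt0.
have k0 : k.+1%:R != 0 :> rat by rewrite pnatr_eq0.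
have -> : (k.+1%:R^-1 + (-1) ^+ k.+1 * 'C(p, k.+1)%:R / p%:R) / p%:R =
    - (((-1) ^+ k * 'C(p.-1, k)%:R - 1) / p%:R) * k.+1%:R^-1 :> rat.
  have -> : 'C(p, k.+1)%:R = p%:R * 'C(p.-1, k)%:R / k.+1%:R :> rat.
    by rewrite -natrM mul_bin_diag natrM mulrC mulKf.
  by rewrite exprS; field; rewrite p0 nat1r k0.
apply: rpredM; last by apply: Zloc_invn; rewrite ?prime_coprime_lt.
by rewrite rpredN bin_pred_prime_Zloc // ltnW.
Qed.

Lemma sum_bin_expr (R : comPzRingType) (n : nat) (x : R) : (0 < n)%N ->
  \sum_(1 <= k < n) 'C(n, k)%:R * x ^+ k = (1 + x) ^+ n - 1 - x ^+ n.
Proof.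
move=> n_gt0; rewrite exprDn.
rewrite -(big_mkord xpredT (fun k => 1 ^+ (n - k) * x ^+ k *+ 'C(n, k))).
rewrite big_ltn // big_nat_recr //= expr1n mul1r expr0 bin0 mulr1n.
rewrite expr1n mul1r binn mulr1n.
under [in RHS]eq_bigr => k _ do rewrite expr1n mul1r -mulr_natl.
by ring.
Qed.

(** Subtracting the expansions of [(1 + x) ^+ n] at [x = 1] and [x = -1] cancels the even terms and
    doubles the odd ones. *)
Lemma sum_bin_odd (n : nat) : odd n ->
  \sum_(1 <= k < n | odd k) 'C(n, k)%:R = 2 ^+ n.-1 - 1 :> rat.
Proof.
move=> n_odd; have n_gt0 := odd_gt0 n_odd.
apply: (@mulfI _ 2) => //.
have -> : 2 * (2 ^+ n.-1 - 1) =
    ((1 + 1) ^+ n - 1 - 1 ^+ n) - ((1 - 1) ^+ n - 1 - (-1) ^+ n) :> rat.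
  rewrite subrr expr0n (gtn_eqF n_gt0) -signr_odd n_odd expr1n mulrBr -exprS.
  by rewrite prednK //= expr1 -[1 + 1]/2; ring.
rewrite -!sum_bin_expr // -sumrB mulr_sumr big_mkcond /=.
apply: eq_bigr => k _; rewrite expr1n -signr_odd.
by case: (odd k); rewrite ?expr0 ?expr1; ring.
Qed.

(** The only added index, [n.-1], is even. *)
Lemma odd_harmonic_pred (n : nat) : odd n ->
  odd_harmonic n.-1 = \sum_(1 <= k < n | odd k) k%:R^-1.
Proof.
case: n => // -[|n] /= n_odd; first by rewrite /odd_harmonic !big_geq.
by rewrite [RHS]big_mkcond big_nat_recr //= (negbTE n_odd) addr0 -big_mkcond.
Qed.

Theorem theorem2 (p : nat) (p_prime : prime p) (p_gt3 : (3 < p)%N) :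
  eqmod_loc p
    (\sum_(1 <= k < p) (k%:R * 2 ^+ k)^-1)
    (odd_harmonic p.-1).
Proof.
have p_gt0 := prime_gt0 p_prime.
have p0 : p%:R != 0 :> rat by rewrite pnatr_eq0 -lt0n.
have p_odd : odd p.
  by case: (even_prime p_prime) => // p2; rewrite p2 in p_gt3.
have half_Zloc : 2^-1 \in Zloc p.
  by rewrite (@Zloc_invn p 2) // prime_coprime_lt // (ltn_trans _ p_gt3).
have inv_Zloc k : (0 < k < p)%N -> k%:R^-1 \in Zloc p.
  move=> kp; rewrite Zloc_invn ?prime_coprime_lt //.
  by case/andP: kp.
rewrite odd_harmonic_pred //.
(* With the error [e k] named, the congruence for [k%:R^-1] becomes the exact identity [invE]. *)
pose e k : rat := (k%:R^-1 + (-1) ^+ k * 'C(p, k)%:R / p%:R) / p%:R.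
pose q : rat := (2 ^+ p.-1 - 1) / p%:R.
(* The Fermat quotient is a sum of the [p]-integral terms ['C(p, k) / p] over odd [k]. *)
have q_Zloc : q \in Zloc p.
  rewrite /q -sum_bin_odd // mulr_suml big_nat_cond rpred_sum // => k.
  by case/andP=> kp _; apply: prime_bin_div_Zloc.
have invE k : k%:R^-1 = - ((-1) ^+ k * 'C(p, k)%:R) / p%:R + p%:R * e k.
  by rewrite /e [p%:R * _]mulrC divfK //; ring.
split.
- rewrite big_nat_cond rpred_sum // => k /andP[kp _].
  by rewrite invfM -exprVn; apply: rpredM; [exact: inv_Zloc | exact: rpredX].
- by rewrite big_nat_cond rpred_sum // => k /andP[kp _]; exact: inv_Zloc.
(* The sums collect the errors of both sides. For the last term put [u = 2 ^+ p.-1 = 1 + p q]: the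
   main parts are [(1 - 1/u) / p = q / u] and [q], with difference [- p q^2 / u]. *)
exists (\sum_(1 <= k < p) e k * 2^-1 ^+ k - \sum_(1 <= k < p | odd k) e k
        - q ^+ 2 * 2^-1 ^+ p.-1).
  apply: rpredB; last by apply: rpredM; exact: rpredX.
  apply: rpredB; rewrite big_nat_cond rpred_sum // => k /andP[kp _].
    by apply: rpredM; [exact: invn_bin_Zloc | exact: rpredX].
  exact: invn_bin_Zloc.
(* The sign in [invE] joins the power of one half: this is the binomial sum at [x = - 2^-1]. *)
have -> : \sum_(1 <= k < p) (k%:R * 2 ^+ k)^-1 =
    - ((1 - 2^-1) ^+ p - 1 - (- 2^-1) ^+ p) / p%:R
    + p%:R * \sum_(1 <= k < p) e k * 2^-1 ^+ k :> rat.
  rewrite -sum_bin_expr // -sumrN mulr_suml mulr_sumr -big_split /=.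
  apply: eq_bigr => k _; rewrite invfM -exprVn (invE k) (exprNn 2^-1); ring.
have -> : \sum_(1 <= k < p | odd k) k%:R^-1 =
    q + p%:R * \sum_(1 <= k < p | odd k) e k :> rat.
  rewrite /q -sum_bin_odd // mulr_suml mulr_sumr -big_split /=.
  by apply: eq_bigr => k k_odd; rewrite (invE k) -signr_odd k_odd; ring.
have -> : 1 - 2^-1 = 2^-1 :> rat by [].
rewrite (exprNn 2^-1) -[(-1) ^+ p]signr_odd p_odd expr1.
have -> : 2^-1 ^+ p = 2^-1 * 2^-1 ^+ p.-1 :> rat by rewrite -exprS prednK.
have t0 : 2 ^+ p.-1 != 0 :> rat by rewrite expf_neq0.
by rewrite /q exprVn; field; rewrite t0 p0.
Qed.
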